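(* Let $r\geq 8$ be an integer. Then the power series expansion around the origin of the rational function $$\frac{1}{1-\sum_{i=1}^r t_i + r!\prod_{i=1}^r t_i}$$ in the variables $t_1,\ldots,t_r$ has only nonnegative coefficients. *)

(* Defs.v *)
(* Formal power series in r variables t_0..t_{r-1} with
   integer coefficients, represented by coefficient functions on
   multi-indices (exponent vectors) {ffun 'I_r -> nat}. *)
From HB Require Import structures.
From mathcomp Require Import all_boot all_order all_algebra.
Set Implicit Arguments. Unset Strict Implicit. Unset Printing Implicit Defensive.
Import Order.TTheory GRing.Theory Num.Theory.
Local Open Scope ring_scope.

Definition midx (r : nat) := {ffun 'I_r -> nat}.

Definition fps (r : nat) := midx r -> int.

Definition midx_sub r (a b : midx r) : midx r := [ffun i => (a i - b i)%N].

Definition midx_bound r (a : midx r) : nat := (\max_(i < r) a i)%N.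

Definition midx_of r (m : nat) (b : {ffun 'I_r -> 'I_m}) : midx r :=
  [ffun i => nat_of_ord (b i)].

(* Cauchy product: (f*g)_a = sum_{b <= a componentwise} f_b g_{a-b};
   the b are enumerated as functions into 'I_(max a + 1). *)
Definition fps_mul r (f g : fps r) : fps r := fun a =>
  \sum_(b : {ffun 'I_r -> 'I_(midx_bound a).+1}
          | [forall i, (b i <= a i)%N])
     f (midx_of b) * g (midx_sub a (midx_of b)).

Definition fps_one r : fps r := fun a => (a == [ffun => 0%N])%:R.

Definition midx_unit r (i : 'I_r) : midx r := [ffun j => (j == i : nat)].

Definition denom_fps (r : nat) : fps r := fun a =>
  (a == [ffun => 0%N])%:R
  - \sum_(i < r) (a == midx_unit i)%:R
  + (r`!)%:R * (a == [ffun => 1%N])%:R.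

Definition is_inverse_of r (f D : fps r) : Prop :=
  forall a, fps_mul f D a = fps_one a.
Arguments denom_fps r _ : clear implicits.

(* Main.v *)
Require Import Defs.
From HB Require Import structures.
From mathcomp Require Import all_boot all_order all_algebra.
From mathcomp Require Import zify ring lra.
Set Implicit Arguments. Unset Strict Implicit. Unset Printing Implicit Defensive.
Import Order.TTheory GRing.Theory Num.Theory.
Local Open Scope ring_scope.

(** Write F a for the coefficients, c = r!, and h a = F a * (prod a_i!) / |a|!
for their normalization by multinomial coefficients.  Differentiating
D F = 1 gives the identity
  b_i F(b-e_j) - b_j F(b-e_i) = c (b_i - b_j) F(b-1)  for i <> j,
so, as long as F is nonnegative in lower degrees, h decreases when a unit is
moved from a larger entry to a smaller one; hence the minimum H_N of h in
degree N is attained at the balanced exponent, with entries differing by at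
most 1.  Since subtracting (1,...,1) from a balanced exponent leaves a balanced
one, the recurrence for F becomes H_N >= H_(N-1) - y_N H_(N-r), where y is
explicit: y_r = 1, and y_N <= 1/(4r) for N >= 2r once r >= 8.  Up to N = 2r-1
the recurrence has a single subtracted term and gives H_(2r-1) >= 3/4; from
there on H loses at most a factor 1 - 1/(2r) per step, so by Bernoulli's
inequality H_(N-r) <= 2 H_(N-1), which reproduces that factor. *)

(** * Exponent vectors in Z^r and their degrees *)

Notation vec r := {ffun 'I_r -> int}.

Definition unitv r (i : 'I_r) : vec r := [ffun j => (j == i)%:R].

Definition onev r : vec r := [ffun => 1].

Definition deg r (a : vec r) : int := \sum_i a i.

Definition nonneg r (a : vec r) : bool := [forall i, 0 <= a i].

(* Power series are extended by 0 to exponents in Z^r, so that the recurrence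
   has no boundary cases. *)
Definition vanishes_outside r (F : vec r -> int) : Prop :=
  forall a, ~~ nonneg a -> F a = 0.

Definition recurrence r (c : int) (F : vec r -> int) : Prop :=
  forall a, F a = (a == 0)%:R + \sum_i F (a - unitv i) - c * F (a - onev r).

Section Vectors.
Variable r : nat.
Implicit Types (a b : vec r) (i j : 'I_r).

Lemma nonnegP a : reflect (forall i, 0 <= a i) (nonneg a).
Proof. exact: forallP. Qed.

Lemma nonneg_unitv i : nonneg (unitv i).
Proof. by apply/nonnegP => j; rewrite ffunE. Qed.

Lemma nonneg_onev : nonneg (onev r).
Proof. by apply/nonnegP => j; rewrite ffunE. Qed.

Lemma not_nonneg a i : a i < 0 -> ~~ nonneg a.
Proof. by move=> ai; apply/nonnegP => /(_ i); rewrite leNgt ai. Qed.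

Lemma deg_add a b : deg (a + b) = deg a + deg b.
Proof. by rewrite /deg -big_split; apply: eq_bigr => i _; rewrite ffunE. Qed.

Lemma deg_sub a b : deg (a - b) = deg a - deg b.
Proof. by rewrite /deg -sumrB; apply: eq_bigr => i _; rewrite !ffunE. Qed.

Lemma deg_unitv i : deg (unitv i) = 1.
Proof.
rewrite /deg (bigD1 i) //= ffunE eqxx big1 ?addr0 // => j /negPf ji.
by rewrite ffunE ji.
Qed.

Lemma deg_onev : deg (onev r) = r%:R.
Proof.
rewrite /deg (eq_bigr (fun=> 1)) => [|i _]; last by rewrite ffunE.
by rewrite sumr_const card_ord.
Qed.

Lemma nonneg_deg a : nonneg a -> 0 <= deg a.
Proof. by move/nonnegP => a0; apply: sumr_ge0. Qed.

Lemma nonneg_le_deg a i : nonneg a -> a i <= deg a.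
Proof.
move/nonnegP => a0; rewrite /deg (bigD1 i) //= lerDl.
by apply: sumr_ge0 => j _.
Qed.

Lemma le_deg_eq a b : (forall i, a i <= b i) -> deg a = deg b -> a = b.
Proof.
move=> ab dab; have E : \sum_i (b i - a i) = 0 by rewrite sumrB -/(deg a) dab subrr.
apply/ffunP => i; apply/eqP; rewrite eq_sym -subr_eq0; apply/eqP.
by apply: (psumr_eq0P _ E) => // j _; rewrite subr_ge0.
Qed.

Lemma nonneg_subU a i : nonneg a -> 0 < a i -> nonneg (a - unitv i).
Proof.
move/nonnegP => a0 ai; apply/nonnegP => j; rewrite !ffunE.
by have := a0 j; case: eqP => [->|_] /=; lia.
Qed.

Lemma nonneg_addU a i : nonneg a -> nonneg (a + unitv i).
Proof.
move/nonnegP => a0; apply/nonnegP => j; rewrite !ffunE.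
by have := a0 j; case: eqP => [->|_] /=; lia.
Qed.

End Vectors.

(** * The exchange identity *)

Section Recurrence.
Variables (r : nat) (c : int) (F : vec r -> int).
Hypotheses (F0 : vanishes_outside F) (FE : recurrence c F).
Implicit Types (a b : vec r) (i j : 'I_r).

Definition exchange_defect i j b : int :=
  b i * F (b - unitv j) - b j * F (b - unitv i)
  - c * (b i - b j) * F (b - onev r).

(** The defect obeys the recurrence without its constant term. Shifting [b] also shifts the factors
    [b i] and [b j]; the resulting corrections cancel between the sum and the [c] term. *)
Lemma exchange_defect_rec i j b : i != j ->
  exchange_defect i j b = \sum_k exchange_defect i j (b - unitv k)
    - c * exchange_defect i j (b - onev r).
Proof.
move=> ij.
have sumU (X : 'I_r -> int) l : \sum_k (l == k)%:R * X k = X l.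
  rewrite (bigD1 l) //= eqxx mul1r big1 ?addr0 // => k.
  by rewrite eq_sym => /negPf ->; rewrite mul0r.
pose A := \sum_k F (b - unitv j - unitv k).
pose B := \sum_k F (b - unitv i - unitv k).
pose C := \sum_k F (b - onev r - unitv k).
have -> : \sum_k exchange_defect i j (b - unitv k) =
    b i * A - b j * B - c * (b i - b j) * C
    + c * (F (b - onev r - unitv i) - F (b - onev r - unitv j)).
  have E k : exchange_defect i j (b - unitv k) =
    b i * F (b - unitv j - unitv k) - b j * F (b - unitv i - unitv k)
    - c * (b i - b j) * F (b - onev r - unitv k)
    - (i == k)%:R * F (b - unitv j - unitv k)
    + (j == k)%:R * F (b - unitv i - unitv k)
    + c * ((i == k)%:R * F (b - onev r - unitv k)
           - (j == k)%:R * F (b - onev r - unitv k)).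
    rewrite /exchange_defect !ffunE.
    rewrite [b - unitv k - unitv j]addrAC [b - unitv k - unitv i]addrAC.
    rewrite [b - unitv k - onev r]addrAC; ring.
  rewrite (eq_bigr _ (fun k _ => E k)) !big_split /= !sumrN -!mulr_sumr.
  rewrite big_split /= !sumrN !sumU (addrAC b (- unitv j)) -/A -/B -/C.
  ring.
(* The delta is nonzero only at [b = unitv j], where [b i = 0]; [di] and [d1] kill the other two
   constant terms likewise. *)
have dj : b i * (b - unitv j == 0)%:R = 0.
  case: eqP => [/ffunP/(_ i)|_]; last by rewrite mulr0.
  by rewrite !ffunE (negPf ij) subr0 => ->; rewrite mul0r.
have di : b j * (b - unitv i == 0)%:R = 0.
  case: eqP => [/ffunP/(_ j)|_]; last by rewrite mulr0.
  by rewrite !ffunE eq_sym (negPf ij) subr0 => ->; rewrite mul0r.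
have d1 : (b i - b j) * (b - onev r == 0)%:R = 0.
  case: eqP => [/ffunP E|_]; last by rewrite mulr0.
  move: (E i) (E j); rewrite !ffunE => /eqP; rewrite subr_eq0 => /eqP ->.
  by move/eqP; rewrite subr_eq0 => /eqP ->; rewrite subrr mul0r.
rewrite /exchange_defect (FE (b - unitv j)) (FE (b - unitv i)) (FE (b - onev r)).
rewrite -/A -/B -/C !ffunE.
rewrite [b - onev r - unitv j]addrAC [b - onev r - unitv i]addrAC.
transitivity (b i * (b - unitv j == 0)%:R - b j * (b - unitv i == 0)%:R
  - c * ((b i - b j) * (b - onev r == 0)%:R)
  + (b i * A - b j * B - c * (b i - b j) * C
  + c * (F (b - unitv i - onev r) - F (b - unitv j - onev r))
  - c * ((b i - 1) * F (b - unitv j - onev r)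
    - (b j - 1) * F (b - unitv i - onev r)
    - c * (b i - b j) * F (b - onev r - onev r)))); first by ring.
rewrite dj di d1; ring.
Qed.

(* With theta_i = t_i d/dt_i and P = prod t_i, D F = 1 gives
   theta_i F = (t_i - c P) F^2; this is the identity obtained by eliminating
   F^2 between theta_i F and theta_j F. *)
Lemma exchange i j b : i != j ->
  b i * F (b - unitv j) - b j * F (b - unitv i)
    = c * (b i - b j) * F (b - onev r).
Proof.
move=> ij; apply/eqP; rewrite -subr_eq0; apply/eqP.
change (exchange_defect i j b = 0).
(* Since r > 0, every shift in the recurrence lowers the degree. Induction on the degree starts
   below 0, where all values of [F] involved vanish. *)
have r0 : (0 < r)%N by case: i {ij} => m; lia.
have [n] : exists n : nat, deg b < n%:Z.
  by exists (absz (deg b)).+1; lia.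
elim: n b => [|n IH] b bn.
  have Fneg (d : vec r) : 0 <= deg d -> F (b - d) = 0.
    move=> d0; apply: F0; apply/negP => /nonneg_deg; rewrite deg_sub; lia.
  by rewrite /exchange_defect !Fneg ?deg_unitv ?deg_onev // !mulr0 !subr0.
rewrite (exchange_defect_rec _ ij) big1 => [|k _].
  rewrite IH ?mulr0 ?subr0 // deg_sub deg_onev; lia.
by rewrite IH // deg_sub deg_unitv; lia.
Qed.

End Recurrence.

(** * Reciprocals of multinomial coefficients *)

Section Weights.
Variable r : nat.
Implicit Types (a b : vec r) (i j : 'I_r).

(** [absz] keeps the weight positive on all of Z^r, so it can always be divided by. *)
Definition weight a : rat :=
  (\prod_i (absz (a i))`!)%N%:R / (absz (deg a))`!%:R.

Lemma weight_gt0 a : 0 < weight a.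
Proof.
rewrite divr_gt0 ?ltr0n ?fact_gt0 ?prodn_gt0 // => i.
exact: fact_gt0.
Qed.

Lemma weight_subU a i : nonneg a -> 0 < a i ->
  weight a * (deg a)%:~R = weight (a - unitv i) * (a i)%:~R.
Proof.
move=> a0 ai; have ad := nonneg_le_deg i a0.
rewrite /weight deg_sub deg_unitv.
rewrite (bigD1 i) //= [in RHS](bigD1 i) //= !ffunE eqxx.
have -> : (\prod_(j < r | j != i) (absz ((a - unitv i)%R j))`! =
           \prod_(j < r | j != i) (absz (a j))`!)%N.
  by apply: eq_bigr => j /negPf ji; rewrite !ffunE ji subr0.
set P := (\prod_(_ < r | _) _)%N.
have [m am] : exists m : nat, a i = m.+1 :> int by exists (absz (a i - 1)); lia.
have [d ed] : exists d : nat, deg a = d.+1 :> int.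
  by exists (absz (deg a - 1)); lia.
rewrite am ed; have -> : absz (m.+1%:Z - 1%:R) = m by lia.
have -> : absz (d.+1%:Z - 1) = d by lia.
rewrite !absz_nat !factS !natrM.
have -> : d.+1%:~R = d.+1%:R :> rat by [].
have -> : m.+1%:~R = m.+1%:R :> rat by [].
have : d`!%:R != 0 :> rat by rewrite pnatr_eq0 -lt0n fact_gt0.
have : d.+1%:R != 0 :> rat by rewrite pnatr_eq0.
move: (d.+1%:R : rat) (d`!%:R : rat) => D D' D0 D'0.
by field; rewrite D0 D'0.
Qed.

Lemma weight_addU a i : nonneg a ->
  weight (a + unitv i) * (deg a + 1)%:~R = weight a * (a i + 1)%:~R.
Proof.
move=> a0; have := @weight_subU (a + unitv i) i (nonneg_addU i a0).
rewrite deg_add deg_unitv addrK !ffunE eqxx; apply.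
by move/nonnegP: a0 => /(_ i) /=; lia.
Qed.

Lemma weight0 : weight 0 = 1.
Proof.
rewrite /weight big1 => [|i _]; last by rewrite ffunE.
by rewrite /deg big1 => [|i _]; rewrite ?ffunE // divr1.
Qed.

Lemma weight_onev : weight (onev r) = r`!%:R^-1.
Proof.
rewrite /weight big1 => [|i _]; last by rewrite ffunE.
by rewrite deg_onev mul1r pmulrn natz.
Qed.

End Weights.

(** * The recurrence for normalized coefficients *)

Section Normalized.
Variables (r : nat) (F : vec r -> int).
Hypotheses (F0 : vanishes_outside F) (FE : recurrence r`!%:R F).
Implicit Types (a b : vec r) (i j : 'I_r).

Definition normcoef a : rat := (F a)%:~R * weight a.

(** The factor acquired by the subtracted term of the recurrence under normalization. *)
Definition yratio a : rat := r`!%:R * weight a / weight (a - onev r).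

Lemma normcoef_ge0 a : (0 <= normcoef a) = (0 <= F a).
Proof. by rewrite pmulr_lge0 ?weight_gt0 // ler0z. Qed.

Lemma yratio_gt0 a : 0 < yratio a.
Proof.
rewrite /yratio; apply: divr_gt0; last exact: weight_gt0.
by apply: mulr_gt0 (weight_gt0 _); rewrite ltr0n fact_gt0.
Qed.

Lemma normcoef0 : (0 < r)%N -> normcoef 0 = 1.
Proof.
move=> r0; pose k := Ordinal r0.
rewrite /normcoef weight0 FE eqxx big1 => [|i _].
  rewrite F0 ?mulr0 ?subr0 //.
  by apply: (@not_nonneg _ _ k); rewrite !ffunE.
by rewrite F0 //; apply: (@not_nonneg _ _ i); rewrite !ffunE eqxx.
Qed.

(** By [weight_subU], normalization turns the sum over [i] into an average: the factors
    [a i / deg a] add up to 1. *)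
Lemma normcoef_rec a : nonneg a -> 0 < deg a ->
  normcoef a = \sum_i (a i)%:~R / (deg a)%:~R * normcoef (a - unitv i)
               - yratio a * normcoef (a - onev r).
Proof.
move=> a0 ad.
have d0 : (deg a)%:~R != 0 :> rat by rewrite intr_eq0; lia.
have an0 : (a == 0) = false.
  apply/eqP => a00; move: ad; rewrite a00 /deg big1 // => i _.
  by rewrite ffunE.
rewrite {1}/normcoef FE an0 add0r intrB intrM mulrBl; congr (_ - _).
  rewrite rmorph_sum mulr_suml; apply: eq_bigr => i _.
  rewrite /normcoef /=.
  have [ai|ai] := ltP 0 (a i).
    have := weight_subU a0 ai; set w := weight a; set w' := weight _ => E.
    transitivity ((F (a - unitv i))%:~R * (w * (deg a)%:~R) / (deg a)%:~R).
      by field.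
    by rewrite E; field.
  (* Here [a i = 0], so [a - unitv i] leaves the orthant and both sides vanish. *)
  rewrite F0 ?mul0r ?mulr0 //; apply: (@not_nonneg _ _ i).
  by rewrite !ffunE eqxx /=; lia.
rewrite /normcoef /yratio.
have := weight_gt0 (a - onev r).
set w := weight a; set w' := weight _ => w0.
have : w' != 0 by rewrite gt_eqF.
by move=> w1; rewrite rmorph_nat; field.
Qed.

Lemma yratio_onev : yratio (onev r) = 1.
Proof.
rewrite /yratio subrr weight0 divr1 weight_onev mulfV //.
by rewrite pnatr_eq0 -lt0n fact_gt0.
Qed.

Lemma yratio_addU a i : nonneg (a - onev r) ->
  yratio (a + unitv i) * (deg a + 1)%:~R * (a i)%:~R =
  yratio a * (a i + 1)%:~R * (deg a - r%:R + 1)%:~R.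
Proof.
move=> a10.
have a0 : nonneg a.
  apply/nonnegP => j; move/nonnegP: a10 => /(_ j).
  by rewrite !ffunE subr_ge0; apply: le_trans.
have E1 := weight_addU i a0.
have E2 := weight_addU i a10.
move: E2; rewrite !ffunE deg_sub deg_onev addrAC => E2.
rewrite subrK in E2.
rewrite /yratio; have := weight_gt0 (a - onev r).
have := weight_gt0 (a + unitv i - onev r).
move: E1 E2.
set w1 := weight (a + _); set w2 := weight a; set w3 := weight _.
set w4 := weight _ => E1 E2 /gt_eqF/negbT w3n /gt_eqF/negbT w4n.
transitivity (r`!%:R * (w1 * (deg a + 1)%:~R) * (w4 * (a i)%:~R) / w3 / w4).
  by field; rewrite w3n w4n.
rewrite E1 -E2; by field; rewrite w3n w4n.
Qed.

End Normalized.

(** * Balanced exponents *)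

Section Balanced.
Variable r : nat.
Hypothesis r0 : (0 < r)%N.
Implicit Types (a b : vec r) (i j : 'I_r).

Definition balanced (N : nat) : vec r :=
  [ffun i : 'I_r => (N %/ r + (i < N %% r)%N)%N%:Z].

Lemma nonneg_balanced N : nonneg (balanced N).
Proof. by apply/nonnegP => i; rewrite ffunE. Qed.

Lemma balanced_le N i j : balanced N i <= balanced N j + 1.
Proof. by clear r0; rewrite !ffunE; case: (_ < _)%N; case: (_ < _)%N; lia. Qed.

Lemma balanced0 : balanced 0 = 0.
Proof. by apply/ffunP => i; rewrite !ffunE div0n mod0n. Qed.

Lemma balanced_subr N : (r <= N)%N -> balanced N - onev r = balanced (N - r).
Proof.
move=> rN; apply/ffunP => i; rewrite !ffunE.
have [n ->] : exists n, N = (n + r)%N by exists (N - r)%N; rewrite subnK.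
rewrite addnK modnDr divnDr ?dvdnn // divnn r0 /=; lia.
Qed.

Lemma balancedS N (i := Ordinal (ltn_pmod N r0)) :
  balanced N.+1 = balanced N + unitv i.
Proof.
apply/ffunP => j; rewrite !ffunE.
have -> : (j == i) = (j == N %% r :> nat)%N by [].
have jr := ltn_ord j.
have := divn_eq N r; have := ltn_pmod N r0.
set q := (N %/ r)%N; set m := (N %% r)%N => mr E.
have [mr1|mr1] := ltnP m.+1 r.
  have -> : (N.+1 %/ r = q)%N by rewrite E -addnS divnMDl // (divn_small mr1) addn0.
  have -> : (N.+1 %% r = m.+1)%N by rewrite E -addnS modnMDl modn_small.
  by case: (ltngtP j m); lia.
(* The unit fills the last position: the quotient rises and the remainder returns to 0. *)
have e : m.+1 = r by lia.
have -> : (N.+1 %/ r = q.+1)%N by rewrite E -addnS e divnMDl // divnn r0 addn1.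
have -> : (N.+1 %% r = 0)%N by rewrite E -addnS e modnMDl modnn.
by case: (ltngtP j m); lia.
Qed.

Lemma deg_balanced N : deg (balanced N) = N%:Z.
Proof.
elim: N => [|N IH].
  by rewrite balanced0 /deg big1 // => i _; rewrite ffunE.
by rewrite balancedS deg_add IH deg_unitv; lia.
Qed.

End Balanced.

(** * Minimality of balanced exponents and recursive bounds for the minima *)

Section Comparison.
Variables (r : nat) (F : vec r -> int).
Hypotheses (F0 : vanishes_outside F) (FE : recurrence r`!%:R F).
Hypothesis r1 : (1 < r)%N.
Implicit Types (a b : vec r) (i j : 'I_r).

Let r0 : (0 < r)%N := ltnW r1.

Definition nonneg_below (N : nat) : Prop :=
  forall a, nonneg a -> deg a < N%:Z -> 0 <= F a.

(** The exchange identity at [b + unitv j] has right side c (b_i - b_j - 1) F(b - 1 + e_j), which is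
    nonnegative; the weights of the two exponents differ by the factor (b_j + 1) / b_i. *)
Lemma normcoef_transfer (b : vec r) i j : nonneg_below (absz (deg b)) ->
  nonneg b -> b j < b i ->
  normcoef F (b - unitv i + unitv j) <= normcoef F b.
Proof.
move=> Fpos b0 bji.
have ij : i != j by apply/eqP => ij; move: bji; rewrite ij ltxx.
have b00 := nonnegP _ b0.
have bi0 : 0 < b i := le_lt_trans (b00 j) bji.
have := exchange F0 FE (b + unitv j) ij.
rewrite addrK !ffunE (negPf ij) eqxx /= addr0 addrAC.
(* The degree here is deg b - r + 1, which is below deg b because r > 1. *)
have Fg : 0 <= F (b - onev r + unitv j).
  have [nn|/F0-> //] := boolP (nonneg (b - onev r + unitv j)).
  apply: Fpos => //.
  rewrite deg_add deg_sub deg_onev deg_unitv.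
  by have := nonneg_deg b0; lia.
have := nonneg_subU b0 bi0 => bi1.
have := weight_addU j bi1.
have := weight_subU b0 bi0.
rewrite deg_sub deg_unitv subrK !ffunE [j == i]eq_sym (negPf ij) /= subr0.
rewrite -[b - onev r + unitv j]addrAC in Fg.
rewrite /normcoef.
have := weight_gt0 b; have := weight_gt0 (b - unitv i).
have := weight_gt0 (b - unitv i + unitv j).
set w1 := weight _; set w2 := weight (_ - _); set w3 := weight _.
move=> w1p w2p w3p E3 E1 E.
have dp : 0 < (deg b)%:~R :> rat.
  by rewrite ltr0z; apply: lt_le_trans (nonneg_le_deg i b0).
have bip : 0 < (b i)%:~R :> rat by rewrite ltr0z.
have {}E1 : w1 = w3 * (b j + 1)%:~R / (b i)%:~R.
  apply: (mulIf (lt0r_neq0 dp)); rewrite E1.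
  have -> : w2 = w3 * (deg b)%:~R / (b i)%:~R by rewrite E3 mulfK ?lt0r_neq0.
  by field; rewrite lt0r_neq0.
rewrite E1 -subr_ge0.
have -> : (F b)%:~R * w3 - (F (b - unitv i + unitv j))%:~R *
    (w3 * (b j + 1)%:~R / (b i)%:~R) =
  (b i * F b - (b j + 1) * F (b - unitv i + unitv j))%:~R * w3 / (b i)%:~R.
  by rewrite intrB !intrM; field; rewrite lt0r_neq0.
apply: divr_ge0; last exact: ltW.
apply: mulr_ge0; last exact: ltW.
rewrite ler0z E; apply: mulr_ge0 Fg; apply: mulr_ge0; first exact: ler0n.
lia.
Qed.

(** Descent on the l1 distance to the balanced exponent t. If b differs from t, then b_i > t_i and
    b_j < t_j for some i, j, and b_j < b_i since entries of t differ by at most 1; moving a unit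
    from i to j shortens the distance by 2. *)
Lemma normcoef_min (N : nat) b : nonneg_below N ->
  nonneg b -> deg b = N%:Z -> normcoef F (balanced r N) <= normcoef F b.
Proof.
move=> Fpos; set t := balanced r N.
have dt : deg t = N%:Z by apply: deg_balanced.
have [n] : exists n : nat, \sum_i `|b i - t i| < n%:Z.
  exists (absz (\sum_i `|b i - t i|)).+1.
  have : 0 <= \sum_i `|b i - t i| by apply: sumr_ge0.
  lia.
elim: n b => [|n IH] b.
  have : 0 <= \sum_i `|b i - t i| by apply: sumr_ge0.
  lia.
move=> bn b0 db.
have [/eqP <- //|bt] := boolP (t == b).
have [i ti] : exists i, t i < b i.
  apply/existsP; apply: contraNT bt => /existsPn no; apply/eqP/esym.
  by apply: le_deg_eq => [k|]; rewrite ?db // leNgt no.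
have [j tj] : exists j, b j < t j.
  apply/existsP; apply: contraNT bt => /existsPn no; apply/eqP.
  by apply: le_deg_eq => [k|]; rewrite ?db // leNgt no.
have tij := balanced_le N j i; rewrite -/t in tij.
have ij : j != i by apply/eqP => ji; move: ti tj; rewrite ji; lia.
have t0 := nonnegP _ (nonneg_balanced r N); rewrite -/t in t0.
apply: (le_trans (y := normcoef F (b - unitv i + unitv j))); last first.
  by apply: normcoef_transfer; rewrite ?db //; lia.
have nn : nonneg (b - unitv i + unitv j).
  apply: nonneg_addU; apply: nonneg_subU => //; have := t0 i; lia.
apply: IH => //; last by rewrite deg_add deg_sub !deg_unitv subrK.
have Ei : (b - unitv i + unitv j) i = b i - 1.
  by rewrite !ffunE eqxx eq_sym (negPf ij) addr0.
have Ej : (b - unitv i + unitv j) j = b j + 1.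
  by rewrite !ffunE eqxx (negPf ij) subr0.
move: bn; rewrite (bigD1 i) //= [X in _ + X](bigD1 j) //=.
rewrite [X in _ -> X < _](bigD1 i) //= [X in _ -> _ + X < _](bigD1 j) //=.
rewrite Ei Ej.
have -> : \sum_(k | (k != i) && (k != j)) `|(b - unitv i + unitv j) k - t k| =
          \sum_(k | (k != i) && (k != j)) `|b k - t k|.
  apply: eq_bigr => k /andP [/negPf ki /negPf kj].
  by rewrite [in LHS]ffunE [in LHS]ffunE !(ffunE _ k) ki kj subr0 addr0.
move: (\sum_(_ | _) _) => S; lia.
Qed.

(** When a variable is absent, the product term of the denominator does not contribute, and the
    coefficient is the multinomial one of 1 / (1 - sum t_i). *)
Lemma normcoef_zero a i : nonneg a -> a i = 0 -> normcoef F a = 1.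
Proof.
have [n] : exists n : nat, deg a < n%:Z by exists (absz (deg a)).+1; lia.
elim: n a => [|n IH] a an a0 ai; first by have := nonneg_deg a0; lia.
have [da|da] := ltP 0 (deg a); last first.
  have -> : a = 0; last exact: normcoef0.
  apply/ffunP => j; rewrite ffunE; apply/eqP; rewrite eq_le.
  by rewrite (nonnegP _ a0) (le_trans (nonneg_le_deg j a0)).
rewrite normcoef_rec // {2}/normcoef [F (a - onev r)]F0; last first.
  by apply: (@not_nonneg _ _ i); rewrite !ffunE ai.
rewrite mul0r mulr0 subr0.
rewrite (eq_bigr (fun j => (a j)%:~R / (deg a)%:~R)) => [|j _].
  by rewrite -mulr_suml -rmorph_sum -/(deg a) mulfV // intr_eq0 gt_eqF.
have [aj|aj] := ltP 0 (a j).
  rewrite IH ?mulr1 //; first by rewrite deg_sub deg_unitv; lia.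
    exact: nonneg_subU.
  rewrite !ffunE ai; case: eqP => // ij; move: aj; rewrite -ij ai; lia.
have -> : a j = 0 by have := nonnegP _ a0 j; lia.
by rewrite !mul0r.
Qed.

Definition minH (N : nat) : rat := normcoef F (balanced r N).

Definition minY (N : nat) : rat := yratio (balanced r N).

(** The comparison exponent is (N, 0, ..., 0), which has a zero entry because r > 1. *)
Lemma minH_le1 N : nonneg_below N -> minH N <= 1.
Proof.
move=> Fpos; pose a : vec r := [ffun i : 'I_r => if i == Ordinal r0 then N%:Z else 0].
have a0 : nonneg a by apply/nonnegP => i; rewrite ffunE; case: ifP.
rewrite -(@normcoef_zero a (Ordinal r1)) //; last by rewrite ffunE.
apply: normcoef_min => //.
rewrite /deg (bigD1 (Ordinal r0)) //= ffunE eqxx big1 ?addr0 // => i /negPf ni.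
by rewrite ffunE ni.
Qed.

Lemma minH_step N : nonneg_below N -> (r <= N)%N ->
  minH N.-1 - minY N * minH (N - r) <= minH N.
Proof.
move=> Fpos rN; have N0 : (0 < N)%N by apply: leq_trans rN.
have Fpos' : nonneg_below N.-1 by move=> a a0 da; apply: Fpos => //; lia.
have b0 := nonneg_balanced r N; have db := deg_balanced r0 N.
rewrite [X in _ <= X]/minH normcoef_rec ?db // balanced_subr //.
rewrite lerD2r.
have -> : minH N.-1 =
   \sum_i (balanced r N i)%:~R / (N%:Z)%:~R * minH N.-1.
  rewrite -mulr_suml -mulr_suml -rmorph_sum /= -/(deg (balanced r N)) db.
  by rewrite mulfV ?mul1r // intr_eq0; lia.
apply: ler_sum => i _.
have [ai|ai] := ltP 0 (balanced r N i); last first.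
  have -> : balanced r N i = 0 by have := nonnegP _ b0 i; lia.
  by rewrite !mul0r.
apply: ler_wpM2l; first by rewrite divr_ge0 // ler0z ltW.
apply: normcoef_min => //; first exact: nonneg_subU.
by rewrite deg_sub db deg_unitv; lia.
Qed.

(** The balanced exponent has k twos and r - k ones. Lowering a one creates a zero entry, hence the
    value 1, so only the twos, of total weight 2k / (r + k), pass on a deficit. *)
Lemma minH_first k : nonneg_below (r + k) -> (k < r)%N ->
  1 - minH (r + k) <=
    (2 * k)%:R / (r + k)%:R * (1 - minH (r + k).-1) + minY (r + k).
Proof.
move=> Fpos kr; set N := (r + k)%N; have N0 : (0 < N)%N by lia.
have Fpos' : nonneg_below N.-1 by move=> a a0 da; apply: Fpos => //; lia.
have b0 := nonneg_balanced r N; have db := deg_balanced r0 N.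
have bE i : balanced r N i = (1 + (i < k)%N)%N%:Z.
  by rewrite ffunE /N divnDl ?dvdnn // divnn r0 divn_small // modnDl modn_small.
have Nn0 : N%:R != 0 :> rat by rewrite pnatr_eq0; lia.
rewrite {1}/minH normcoef_rec ?db // balanced_subr //; last by rewrite /N leq_addr.
(* The exponent [balanced r k] with k < r has a zero at position k. *)
have -> : normcoef F (balanced r (N - r)) = 1.
  apply: (@normcoef_zero _ (Ordinal kr)) (nonneg_balanced _ _) _.
  by rewrite ffunE /N addKn divn_small // modn_small // ltnn.
rewrite mulr1 opprB addrCA [X in _ <= X]addrC lerD2l.
have {1}-> : 1 = \sum_i (balanced r N i)%:~R / (N%:Z)%:~R :> rat.
  rewrite -mulr_suml -rmorph_sum /= -/(deg (balanced r N)) db.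
  by rewrite mulfV // intr_eq0; lia.
rewrite -sumrB.
have -> : (2 * k)%:R / N%:R * (1 - minH N.-1) =
    \sum_(i < r | (i < k)%N) 2 / N%:R * (1 - minH N.-1).
  rewrite -(big_ord_widen r (fun=> 2 / N%:R * (1 - minH N.-1)) (ltnW kr)).
  by rewrite sumr_const card_ord natrM -[RHS]mulr_natr; field.
rewrite [X in _ <= X]big_mkcond; apply: ler_sum => i _.
rewrite -[X in X - _ <= _]mulr1 -mulrBr bE.
case: ifP => ik /=.
  apply: ler_wpM2l; first by rewrite divr_ge0 ?ler0n.
  rewrite lerD2l lerN2.
  apply: normcoef_min => //.
    by apply: nonneg_subU => //; rewrite bE.
  by rewrite deg_sub db deg_unitv; lia.
rewrite (@normcoef_zero _ i) ?subrr ?mulr0 //.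
  by apply: nonneg_subU => //; rewrite bE.
by rewrite !ffunE eqxx; have := bE i; rewrite ffunE ik => ->.
Qed.

Lemma minY_r : minY r = 1.
Proof.
rewrite /minY; have -> : balanced r r = onev r; last exact: yratio_onev.
by apply/ffunP => i; rewrite !ffunE divnn r0 modnn.
Qed.

Lemma minY_gt0 N : 0 < minY N.
Proof. exact: yratio_gt0. Qed.

Lemma minYS N : (r <= N)%N ->
  minY N.+1 * (N.+1)%:R * (N %/ r)%:R =
  minY N * (N %/ r).+1%:R * (N - r).+1%:R.
Proof.
move=> rN; rewrite /minY (balancedS r0).
set i := Ordinal _.
have bi : balanced r N i = (N %/ r)%:Z by rewrite ffunE ltnn addn0.
have := @yratio_addU _ (balanced r N) i; rewrite balanced_subr //.
move=> /(_ (nonneg_balanced _ _)).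
rewrite deg_balanced // bi.
have -> : N%:Z + 1 = N.+1%:Z by lia.
have -> : (N %/ r)%:Z + 1 = (N %/ r).+1%:Z by lia.
have -> : N%:Z - r%:R + 1 = (N - r).+1%:Z by lia.
by [].
Qed.

Lemma minY_noninc N : (r <= N)%N -> minY N.+1 <= minY N.
Proof.
move=> rN; have E := minYS rN.
have q0 : (0 < N %/ r)%N by rewrite divn_gt0.
have p : 0 < (N.+1)%:R * (N %/ r)%:R :> rat by rewrite -natrM ltr0n muln_gt0.
rewrite -(ler_pM2r p) mulrA E -mulrA; apply: ler_wpM2l.
  exact/ltW/minY_gt0.
(* With q = N / r this says (q + 1)(N + 1 - r) <= q (N + 1), that is, N + 1 <= r (q + 1). *)
rewrite -!natrM ler_nat.
have := divn_eq N r; have := ltn_pmod N r0; nia.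
Qed.

Lemma minY_first k : (0 < k <= r)%N ->
  minY (r + k) * (r + k)%:R = minY (r + k).-1 * (2 * k)%:R.
Proof.
case: k => // k /= kr; have := @minYS (r + k); rewrite leq_addr => /(_ isT).
rewrite divnDl ?dvdnn // divnn r0 divn_small // addn0 addKn mulr1 addnS /=.
by rewrite natrM mulrA.
Qed.

End Comparison.

(** Equivalent to 4 n 2^n <= binom(2n, n), which gives y_(2r) <= 1/(4r). This is where 8 comes from:
    at n = 7 one has 3584 > 3432. The induction step reduces to (n + 1)^2 <= n (2n + 1). *)
Lemma fact_double_ge n : (8 <= n)%N ->
  (4 * n * (2 ^ n * n`! * n`!) <= (n + n)`!)%N.
Proof.
elim: n => // n IH; rewrite leq_eqVlt => /orP [/eqP <-|n8].
  by rewrite /= !factS fact0 !expnS expn0; lia.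
have {IH} := IH n8; rewrite addSn addnS !factS expnS.
set X := (2 ^ n)%N; set f := n`!; set Y := (n + n)`! => h.
have -> : (4 * n.+1 * (2 * X * (n.+1 * f) * (n.+1 * f)) =
           8 * n.+1 * (n.+1 * n.+1) * (X * f * f))%N by ring.
apply: (@leq_trans ((n + n).+2 * ((n + n).+1 * (4 * n * (X * f * f)))))%N.
  have -> : ((n + n).+2 * ((n + n).+1 * (4 * n * (X * f * f))) =
           8 * n.+1 * (n * (n + n).+1) * (X * f * f))%N by ring.
  by rewrite leq_mul2r leq_mul2l; apply/orP; right; apply/orP; right; nia.
by rewrite !leq_mul2l h !orbT.
Qed.

(** * Nonnegativity of a rational sequence with a delayed negative term *)

Section NumericRecursion.
Variables (r : nat) (H y : nat -> rat).
Hypothesis r8 : (8 <= r)%N.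
Hypothesis y_gt0 : forall N, 0 < y N.
Hypothesis yr : y r = 1.
Hypothesis y_first : forall k, (0 < k <= r)%N ->
  y (r + k)%N * (r + k)%:R = y (r + k).-1 * (2 * k)%:R.
Hypothesis y_noninc : forall N, (r <= N)%N -> y N.+1 <= y N.

Let Q : rat := (4 * r)%:R^-1.

Lemma y_fact k : (k <= r)%N ->
  y (r + k)%N * (r + k)`!%:R = (2 ^ k * k`! * r`!)%N%:R.
Proof.
elim: k => [|k IH] kr.
  by rewrite addn0 yr expn0 fact0 mul1r !mul1n.
have := @y_first k.+1 kr; have := IH (ltnW kr); rewrite addnS /= !factS expnS.
rewrite !natrM => E1 E2; rewrite mulrA E2 mulrAC E1; ring.
Qed.

Lemma y_double : y (r + r)%N <= Q.
Proof.
have F0 : 0 < (r + r)`!%:R :> rat by rewrite ltr0n fact_gt0.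
rewrite -(ler_pM2r F0) y_fact // ler_pdivlMl; last by rewrite ltr0n; lia.
by rewrite -natrM ler_nat fact_double_ge.
Qed.

Lemma y_large N : (r + r <= N)%N -> y N <= Q.
Proof.
move=> /subnK <-; elim: (N - (r + r))%N => [|n IH]; first exact: y_double.
by apply: le_trans IH; rewrite addSn y_noninc //; lia.
Qed.

(** At k = r the ratio 2k / (r + k) equals 1, so y_(2r-1) = y_(2r). *)
Lemma y_last : y (r + r.-1)%N <= Q.
Proof.
have := @y_first r; rewrite leqnn andbT => /(_ (leq_trans _ r8)) E.
have rr : (r + r)%:R != 0 :> rat by rewrite pnatr_eq0; lia.
have {E} := E isT; rewrite mul2n -addnn => /(mulIf rr).
have -> : (r + r).-1 = (r + r.-1)%N by lia.
by move=> <-; apply: y_double.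
Qed.

Lemma y_first_le k : (k < r)%N -> k.+1%:R * y (r + k)%N <= 1.
Proof.
(* The inductive factor 2(k + 2) / (r + k + 1) is at most 1 only while k + 3 <= r, so the last index
   is treated apart, using [y_last]. *)
have [->|kr1 kr] := eqVneq k r.-1.
  move=> _; have := y_last; set Y := y _ => yY.
  rewrite prednK; last by lia.
  apply: le_trans (_ : r%:R * Q <= 1).
    by apply: ler_wpM2l yY; rewrite ler0n.
  rewrite /Q natrM invfM mulrCA mulfV ?mulr1; last by rewrite pnatr_eq0; lia.
  by [].
have {kr1 kr} : (k.+1 < r)%N by lia.
elim: k => [|k IH] kr; first by rewrite addn0 yr mul1r.
have p : 0 < (r + k.+1)%:R :> rat by rewrite ltr0n; lia.
rewrite -(ler_pM2r p) -mulrA y_first; last by lia.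
have -> : k.+2%:R * (y (r + k.+1).-1 * (2 * k.+1)%:R) =
    (2 * k.+2)%:R * (k.+1%:R * y (r + k)%N) by rewrite addnS !natrM /=; ring.
apply: le_trans (ler_wpM2l (ler0n _ _) (IH (ltnW kr))) _.
by rewrite mulr1 mul1r ler_nat; lia.
Qed.

Definition positive_below N := forall M, (M < N)%N -> 0 <= H M.

Hypothesis H_small : forall N, (N < r)%N -> 0 <= H N.
Hypothesis H_le1 : forall N, positive_below N -> H N <= 1.
Hypothesis H_step : forall N, positive_below N -> (r <= N)%N ->
  H N.-1 - y N * H (N - r)%N <= H N.
Hypothesis H_first : forall k, positive_below (r + k) -> (k < r)%N ->
  1 - H (r + k)%N <=
    (2 * k)%:R / (r + k)%:R * (1 - H (r + k).-1) + y (r + k)%N.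

(** The deficit bound in [H_first] and y itself carry the same factor 2k / (r + k), so the quotient
    of deficit by y grows by at most 1 per step. *)
Lemma H_first_ge k : positive_below (r + k) -> (k < r)%N ->
  1 - H (r + k)%N <= k.+1%:R * y (r + k)%N.
Proof.
elim: k => [|k IH] Hpos kr.
  by have := H_first Hpos kr; rewrite muln0 !mul0r add0r mul1r.
have Hpos1 : positive_below (r + k) by move=> M Mk; apply: Hpos; lia.
have {}IH := IH Hpos1 (ltnW kr).
apply: (le_trans (H_first Hpos kr)).
have -> : k.+2%:R = k.+1%:R + 1 :> rat by rewrite -natr1.
rewrite mulrDl mul1r lerD2r.
have p : 0 < (r + k.+1)%:R :> rat by rewrite ltr0n; lia.
rewrite mulrAC ler_pdivrMr // -mulrA y_first; last by lia.
rewrite addnS /= mulrA [_ * (2 * k.+1)%:R]mulrC; apply: ler_wpM2l => //.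
Qed.

Lemma H_ge0 N : 0 <= H N.
Proof.
have Q0 : 0 < Q by rewrite invr_gt0 ltr0n; lia.
have rQ : r%:R * Q = 4^-1.
  rewrite /Q natrM invfM mulrCA mulfV ?mulr1 // pnatr_eq0; lia.
have Q4 : Q <= 4^-1 by rewrite -rQ ler_peMl ?(ltW Q0) // ler1n; lia.
(* The induction carries two more bounds: a linear one from 3/4 at N = 2r - 1, losing [Q] per step
   up to 3r - 1, and a geometric one from 2r on. The first keeps H >= 1/2, since r Q = 1/4, so a
   loss of [Q] is at most the fraction 2Q of H. *)
suff : [/\ 0 <= H N,
  (r + r <= N.+1)%N -> (N < r + r + r)%N ->
    3 / 4 - (N.+1 - (r + r))%:R * Q <= H N &
  (r + r <= N)%N -> (1 - 2 * Q) * H N.-1 <= H N] by case.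
have [n] := ubnP N; elim: n N => [//|n IH] N; rewrite ltnS => Nn.
have {}IH M : (M < N)%N -> _ := fun MN => IH M (leq_trans MN Nn).
have Hpos : positive_below N by move=> M /IH [].
have [Nr|rN] := ltnP N r.
  by split; [exact: H_small|lia|lia].
have [N2r|rrN] := ltnP N (r + r).
  have [k kr Nk] : exists2 k, (k < r)%N & N = (r + k)%N by exists (N - r)%N; lia.
  have := H_first_ge (k := k); rewrite -Nk => /(_ Hpos kr) Hk.
  have yk := y_first_le kr; rewrite -Nk in yk.
  split; [lra| |lia].
  (* Only N = 2r - 1 remains, where the deficit is at most r y_N <= r Q = 1/4. *)
  move=> h _; have kE : k = r.-1 by lia.
  have -> : (N.+1 - (r + r) = 0)%N by lia.
  rewrite mul0r subr0.
  suff : k.+1%:R * y N <= 4^-1 by lra.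
  rewrite kE prednK ?(leq_trans _ r8) // -rQ; apply: ler_wpM2l; first exact: ler0n.
  have -> : N = (r + r.-1)%N by lia.
  exact: y_last.
have yQ := y_large rrN; have yp := y_gt0 N.
have HN := H_step Hpos rN.
have HNr0 : 0 <= H (N - r)%N by apply: Hpos; lia.
have HN1 : 0 <= H N.-1 by apply: Hpos; lia.
have [N3r|rrrN] := ltnP N (r + r + r).
  have HNr1 : H (N - r)%N <= 1.
    by apply: H_le1 => M MN; apply: Hpos; lia.
  have yH : y N * H (N - r)%N <= Q.
    by apply: le_trans yQ; rewrite ler_piMr // ltW.
  have [|_ hlin _] := IH N.-1; first by lia.
  have {}hlin : 3 / 4 - (N - (r + r))%:R * Q <= H N.-1.
    by move: hlin; clear - r8 rrN N3r; rewrite prednK; [apply; lia|lia].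
  have nQ : (N - (r + r))%:R * Q <= 4^-1.
    by rewrite -rQ ler_pM2r // ler_nat; clear - N3r; lia.
  split=> [|_ _|_].
  - lra.
  - have -> : (N.+1 - (r + r) = (N - (r + r)).+1)%N by exact: subSn.
    by rewrite -natr1 mulrDl mul1r; lra.
  - nra.
(* Bernoulli's inequality for j geometric steps back from N - 1; these stay at indices at least 2r
   because N >= 3r. *)
have chain j : (j < r)%N -> (1 - j%:R * (2 * Q)) * H (N.-1 - j)%N <= H N.-1.
  elim: j => [|j IHj] jr; first by rewrite mul0r subr0 mul1r subn0.
  apply: le_trans (IHj (ltnW jr)).
  have [|_ _ hr] := IH (N.-1 - j)%N; first by lia.
  have {}hr : (1 - 2 * Q) * H (N.-1 - j.+1)%N <= H (N.-1 - j)%N.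
    by move: hr; rewrite -subnS; apply; clear - jr rrrN; lia.
  have Hj : 0 <= H (N.-1 - j.+1)%N by apply: Hpos; lia.
  have jQ : j%:R * Q <= 4^-1 by rewrite -rQ ler_pM2r // ler_nat ltnW // ltnW.
  have jQ0 : 0 <= j%:R * Q by rewrite mulr_ge0 ?ler0n // ltW.
  have jQ1 : 0 <= 1 - j%:R * (2 * Q) by lra.
  apply: (le_trans _ (ler_wpM2l jQ1 hr)).
  rewrite [X in _ <= X]mulrA; apply: ler_wpM2r => //; rewrite -natr1; nra.
have := chain r.-1; have -> : (N.-1 - r.-1 = N - r)%N by lia.
have r1Q : r.-1%:R * Q <= 4^-1 by rewrite -rQ ler_pM2r // ler_nat; lia.
move=> hc.
(* For j = r - 1 the factor is 1 - 2(r - 1)Q >= 1/2. *)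
have {}hc : H (N - r)%N <= 2 * H N.-1.
  have r1r : (r.-1 < r)%N by clear - r8; lia.
  have := hc r1r; nra.
have yH : y N * H (N - r)%N <= Q * (2 * H N.-1).
  by apply: ler_pM => //; exact: ltW.
have QH : Q * H N.-1 <= 4^-1 * H N.-1 by exact: ler_wpM2r.
by split=> [|//|_]; lra.
Qed.

End NumericRecursion.

Lemma recurrence_ge0 r (F : vec r -> int) : (8 <= r)%N ->
  vanishes_outside F -> recurrence r`!%:R F -> forall a, 0 <= F a.
Proof.
move=> r8 F0 FE; have r1 : (1 < r)%N by lia.
have r0 : (0 < r)%N by lia.
(* Nonnegative minima below N make all coefficients of degree below N nonnegative: minimality in a
   given degree uses only lower degrees. This supplies the hypothesis of the bounds on [minH]. *)
have below N : positive_below (minH F) N -> nonneg_below F N.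
  elim: N => [_ a /nonneg_deg|N IH Hpos a a0 aN]; first by lia.
  have Fpos : nonneg_below F N by apply: IH => M MN; apply: Hpos; lia.
  have [aN1|aN1] := ltP (deg a) N%:Z; first exact: Fpos.
  rewrite -normcoef_ge0; apply: le_trans (Hpos N (ltnSn N)) _.
  by apply: normcoef_min => //; lia.
have H0 : forall N, 0 <= minH F N.
  apply: (@H_ge0 r _ (@minY r)) => //.
  - by move=> N; apply: minY_gt0.
  - exact: minY_r.
  - by move=> k; apply: minY_first.
  - by move=> N; apply: minY_noninc.
  (* For N < r the balanced exponent has a zero at position N, so the minimum is 1. *)
  - move=> N Nr; rewrite /minH.
    rewrite (@normcoef_zero _ _ F0 FE r1 _ (Ordinal Nr)) //.
      exact: nonneg_balanced.
    by rewrite ffunE divn_small // modn_small // ltnn.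
  - by move=> N /below; apply: minH_le1.
  - by move=> N /below; apply: minH_step.
  - by move=> k /below; apply: minH_first.
move=> a; have [a0|/F0-> //] := boolP (nonneg a).
apply: (below (absz (deg a)).+1) => //; have := nonneg_deg a0; lia.
Qed.

(** * Power series and their extension by zero to Z^r *)

Definition to_vec r (a : midx r) : vec r := [ffun i => (a i)%:Z].

Definition of_vec r (a : vec r) : midx r := [ffun i => absz (a i)].

Definition extend r (f : fps r) (a : vec r) : int :=
  if nonneg a then f (of_vec a) else 0.

Lemma to_vecK r : cancel (@to_vec r) (@of_vec r).
Proof. by move=> a; apply/ffunP => i; rewrite !ffunE. Qed.

Lemma of_vecK r (a : vec r) : nonneg a -> to_vec (of_vec a) = a.
Proof.
by move/nonnegP => a0; apply/ffunP => i; rewrite !ffunE gez0_abs.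
Qed.

Lemma nonneg_to_vec r (a : midx r) : nonneg (to_vec a).
Proof. by apply/nonnegP => i; rewrite ffunE. Qed.

Lemma extend_vanishes r (f : fps r) : vanishes_outside (extend f).
Proof. by move=> a /negPf a0; rewrite /extend a0. Qed.

Lemma extend_to_vec r (f : fps r) a : extend f (to_vec a) = f a.
Proof. by rewrite /extend nonneg_to_vec to_vecK. Qed.

Lemma to_vec_eq0 r (a : midx r) : (to_vec a == 0) = (a == [ffun => 0%N]).
Proof.
rewrite -(can_eq (@to_vecK r)); congr (_ == _).
by apply/ffunP => i; rewrite !ffunE.
Qed.

(** Convolution with a monomial is a shift: only b = a - d contributes, and if d exceeds a somewhere
    both sides are 0. Truncated subtraction is exact because b <= a. *)
Lemma conv_delta r (f : fps r) (a d : midx r) :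
  \sum_(b : {ffun 'I_r -> 'I_(midx_bound a).+1} | [forall i, (b i <= a i)%N])
     f (midx_of b) * (midx_sub a (midx_of b) == d)%:R
  = extend f (to_vec a - to_vec d).
Proof.
have bound i : (a i <= midx_bound a)%N by apply: leq_bigmax.
rewrite /extend; have [/nonnegP da|da] := boolP (nonneg _); last first.
  rewrite big1 // => b /forallP ba.
  case: eqP => [E|_]; last by rewrite mulr0.
  case/negP: da; apply/nonnegP => i.
  by rewrite !ffunE -E !ffunE; have := ba i; lia.
have {}da i : (d i <= a i)%N by have := da i; rewrite !ffunE; lia.
pose b0 : {ffun 'I_r -> 'I_(midx_bound a).+1} := [ffun i => inord (a i - d i)].
have b0E i : b0 i = (a i - d i)%N :> nat.
  by rewrite ffunE inordK // ltnS (leq_trans (leq_subr _ _)).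
rewrite (bigD1 b0) /=; last by apply/forallP => i; rewrite b0E leq_subr.
rewrite big1 => [|b /andP [/forallP ba bb0]]; last first.
  case: eqP => [E|_]; last by rewrite mulr0.
  case/eqP: bb0; apply/ffunP => i; apply: val_inj => /=; rewrite b0E -E !ffunE.
  by rewrite subKn.
have -> : midx_sub a (midx_of b0) = d.
  by apply/ffunP => i; rewrite ffunE [X in (_ - X)%N]ffunE b0E subKn.
rewrite eqxx mulr1 addr0; congr f; apply/ffunP => i.
by rewrite [LHS]ffunE b0E !ffunE; have := da i; lia.
Qed.

Lemma fps_mul_denom r (f : fps r) a :
  fps_mul f (denom_fps r) a =
  extend f (to_vec a) - \sum_i extend f (to_vec a - unitv i)
    + r`!%:R * extend f (to_vec a - onev r).
Proof.
have E0 : to_vec a = to_vec a - to_vec [ffun => 0%N].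
  by apply/ffunP => i; rewrite !ffunE subr0.
have EU (i : 'I_r) : unitv i = to_vec (midx_unit i).
  by apply/ffunP => j; rewrite !ffunE; case: eqP.
have E1 : onev r = to_vec [ffun => 1%N] by apply/ffunP => i; rewrite !ffunE.
rewrite [in extend f (to_vec a)]E0 E1 -!conv_delta.
under [X in _ - X]eq_bigr do rewrite EU -conv_delta.
rewrite exchange_big /= mulr_sumr -sumrB -big_split /=.
apply: eq_bigr => b _; rewrite /denom_fps mulrDr mulrBr mulr_sumr.
by congr (_ + _); rewrite mulrCA.
Qed.

(** Off the orthant all terms vanish, since subtracting a nonnegative vector cannot lead back into
    it. *)
Lemma recurrence_nonneg r c (F : vec r -> int) : vanishes_outside F ->
  (forall a, nonneg a ->
     F a = (a == 0)%:R + \sum_i F (a - unitv i) - c * F (a - onev r)) ->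
  recurrence c F.
Proof.
move=> F0 FE a; have [/FE //|a0] := boolP (nonneg a).
have an0 : (a == 0) = false.
  by apply: contraNF a0 => /eqP ->; apply/nonnegP => i; rewrite ffunE.
have Fa d : nonneg d -> F (a - d) = 0.
  move=> d0; apply: F0; apply: contraNN a0 => ad.
  apply/nonnegP => i; have := nonnegP _ ad i; have := nonnegP _ d0 i.
  by rewrite !ffunE subr_ge0; apply: le_trans.
rewrite F0 // an0 big1 => [|i _]; last by rewrite Fa // nonneg_unitv.
by rewrite Fa ?nonneg_onev // mulr0 subr0.
Qed.

Lemma is_inverse_recurrence r (f : fps r) :
  is_inverse_of f (denom_fps r) <-> recurrence r`!%:R (extend f).
Proof.
split=> [inv a|rec a]; last first.
  rewrite fps_mul_denom rec to_vec_eq0 /fps_one; ring.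
move: a; apply: recurrence_nonneg (@extend_vanishes _ f) _ => a a0.
have := inv (of_vec a); rewrite fps_mul_denom /fps_one -to_vec_eq0 of_vecK //.
move=> <-; ring.
Qed.

(** * Existence of the inverse series *)

Section Existence.
Variables (r : nat) (c : int).
Hypothesis r0 : (0 < r)%N.

(** The recurrence is not structural on vectors, so the recursion is on a fuel; fuel above the
    degree gives the final value. *)
Fixpoint fuel_solution n (a : vec r) : int :=
  if n is m.+1 then
    if nonneg a then (a == 0)%:R + \sum_i fuel_solution m (a - unitv i)
                     - c * fuel_solution m (a - onev r)
    else 0
  else 0.

Lemma fuel_solution_vanishes n : vanishes_outside (fuel_solution n).
Proof. by case: n => // n a /= /negPf ->. Qed.

Lemma fuel_solutionE n a : nonneg a ->
  fuel_solution n.+1 a = (a == 0)%:R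
    + \sum_i fuel_solution n (a - unitv i) - c * fuel_solution n (a - onev r).
Proof. by move=> /= ->. Qed.

Lemma fuel_solutionS n a : deg a < n%:Z ->
  fuel_solution n.+1 a = fuel_solution n a.
Proof.
elim: n a => [|n IH] a an.
  by rewrite fuel_solution_vanishes //; apply/negP => /nonneg_deg; lia.
have [a0|a0] := boolP (nonneg a); last by rewrite !fuel_solution_vanishes.
rewrite [LHS]fuel_solutionE // [RHS]fuel_solutionE //.
rewrite IH; last by rewrite deg_sub deg_onev; lia.
congr (_ + _ - _); apply: eq_bigr => i _.
by rewrite IH // deg_sub deg_unitv; lia.
Qed.

Lemma fuel_solution_stable n m a : deg a < n%:Z -> (n <= m)%N ->
  fuel_solution m a = fuel_solution n a.
Proof.
move=> an /subnK <-; elim: (m - n)%N => // k IH.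
by rewrite addSn fuel_solutionS // PoszD; lia.
Qed.

Lemma recurrence_solvable :
  exists2 F : vec r -> int, vanishes_outside F & recurrence c F.
Proof.
pose F a := fuel_solution (absz (deg a)).+1 a.
have F0 : vanishes_outside F by move=> a; apply: fuel_solution_vanishes.
exists F => //; apply: recurrence_nonneg => // a a0.
(* The fuel left after one unfolding is deg a, which exceeds the degree of [a - d]. *)
have FE (d : vec r) : 0 < deg d -> F (a - d) = fuel_solution (absz (deg a)) (a - d).
  move=> dd; have [ad|ad] := boolP (nonneg (a - d)); last first.
    by rewrite F0 // fuel_solution_vanishes.
  have := nonneg_deg ad; have := nonneg_deg a0; have := deg_sub a d => E Ea Ed.
  by symmetry; apply: fuel_solution_stable; lia.
rewrite {1}/F fuel_solutionE // FE ?deg_onev; last by lia.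
by under [in RHS]eq_bigr do rewrite FE ?deg_unitv //.
Qed.

End Existence.

Theorem theorem1 (r : nat) (hr : (8 <= r)%N) :
  (exists f : fps r, is_inverse_of f (denom_fps r)) /\
  (forall f : fps r, is_inverse_of f (denom_fps r) ->
     forall a : midx r, 0 <= f a).
Proof.
split=> [|f /is_inverse_recurrence rec a]; last first.
  rewrite -extend_to_vec; apply: recurrence_ge0 => //.
  exact: extend_vanishes.
have r0 : (0 < r)%N by lia.
have [F F0 FE] := recurrence_solvable r`!%:R r0.
have extF : extend (fun a => F (to_vec a)) =1 F.
  move=> a; rewrite /extend; case: ifP => [a0|/negbT/F0-> //].
  by rewrite of_vecK.
exists (fun a => F (to_vec a)); apply/is_inverse_recurrence => a.
rewrite !extF FE; congr (_ + _ - _).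
by apply: eq_bigr => i _; rewrite extF.
Qed.
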